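(* Let $\delta\in\{0,1\}$, and let $a_{21},b_1,b_2\ge0$ be parameters of an explicit second order two-stage Runge-Kutta scheme, i.e. $b_1+b_2=1$ and $a_{21}b_2=\frac12$. The two-stage modified Patankar-Runge-Kutta scheme $$y_i^{(1)}=y_i^n,$$ $$y_i^{(2)}=y_i^n+a_{21}\Delta t\sum_{j=1}^N\Bigl(p_{ij}(\mathbf y^{(1)})(1-\delta)+p_{ij}(\mathbf y^{(1)})\frac{y_j^{(2)}}{\pi_j}\delta-d_{ij}(\mathbf y^{(1)})\frac{y_i^{(2)}}{\pi_i}\Bigr),$$ $$y_i^{n+1}=y_i^n+\Delta t\sum_{j=1}^N\Bigl(\bigl(b_1p_{ij}(\mathbf y^{(1)})+b_2p_{ij}(\mathbf y^{(2)})\bigr)\frac{y_j^{n+1}}{\sigma_j}-\bigl(b_1d_{ij}(\mathbf y^{(1)})+b_2d_{ij}(\mathbf y^{(2)})\bigr)\frac{y_i^{n+1}}{\sigma_i}\Bigr),$$ $i=1,\dots,N$, with $$\pi_i=y_i^n,\qquad \sigma_i=y_i^n\left(\frac{y_i^{(2)}}{y_i^n}\right)^{1/a_{21}},\qquad i=1,\dots,N,$$ is second order accurate.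
   Context: A production-destruction system (PDS) is an ODE system $y_i'(t)=P_i(\mathbf y(t))-D_i(\mathbf y(t))$, $i=1,\dots,N$, with $P_i(\mathbf y)=\sum_{j=1}^N p_{ij}(\mathbf y)$, $D_i(\mathbf y)=\sum_{j=1}^N d_{ij}(\mathbf y)$, where $p_{ij},d_{ij}\ge 0$ are defined for $\mathbf y\ge 0$ (componentwise) and are twice continuously differentiable on $(0,\infty)^N$. The PDS is positive if positive initial values imply positive solutions for all $t>0$. It is fully conservative if $p_{ij}(\mathbf y)=d_{ji}(\mathbf y)$ and $p_{ii}(\mathbf y)=d_{ii}(\mathbf y)=0$ for all $i,j$ and $\mathbf y\ge0$. All PDS considered are positive and fully conservative. Second order accurate means: for every positive fully conservative PDS with $N$ constituents and every $\mathbf y^n\in(0,\infty)^N$, if $\mathbf y(t)$ is the solution with $\mathbf y(t^n)=\mathbf y^n$ and $t^{n+1}=t^n+\Delta t$, then $y_i^{n+1}-y_i(t^{n+1})=\mathcal O(\Delta t^3)$ as $\Delta t\to0^+$ (PDS and $\mathbf y^n$ fixed) for $i=1,\dots,N$. *)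

(* Defs.v *)
From HB Require Import structures.
From mathcomp Require Import all_boot all_order all_algebra.
From mathcomp Require Export all_classical all_reals all_analysis.
Export Order.TTheory GRing.Theory Num.Theory.
Export numFieldNormedType.Exports.

Set Implicit Arguments.
Unset Strict Implicit.
Unset Printing Implicit Defensive.

Local Open Scope classical_set_scope.
Local Open Scope ring_scope.

Definition pos_vec (R : realType) (N : nat) : set 'rV[R]_N :=
  [set y | forall i, 0 < y 0 i].

Definition nonneg_vec (R : realType) (N : nat) : set 'rV[R]_N :=
  [set y | forall i, 0 <= y 0 i].

(* For an open set [A]: all iterated partial derivatives of [f] of order at
   most [k] exist and are continuous on [A]. *)
Fixpoint continuously_differentiable (R : realType) (N : nat) (k : nat)
    (A : set 'rV[R]_N) (f : 'rV[R]_N -> R) : Prop :=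
  (forall y, A y -> {for y, continuous f}) /\
  (if k is k'.+1 then
     forall j : 'I_N,
       (forall y, A y -> derivable f y (delta_mx 0 j)) /\
       continuously_differentiable k' A (fun y => 'D_(delta_mx 0 j) f y)
   else True).

(* The rates are total functions, but only their values on [nonneg_vec] are
   ever constrained or used. *)
Record pds (R : realType) (N : nat) := Pds {
  prod_rate : 'I_N -> 'I_N -> 'rV[R]_N -> R ;
  dest_rate : 'I_N -> 'I_N -> 'rV[R]_N -> R ;
  prod_rate_ge0 : forall i j y, nonneg_vec y -> 0 <= prod_rate i j y ;
  dest_rate_ge0 : forall i j y, nonneg_vec y -> 0 <= dest_rate i j y ;
  prod_rate_C2 : forall i j,
    continuously_differentiable 2 (@pos_vec R N) (prod_rate i j) ;
  dest_rate_C2 : forall i j,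
    continuously_differentiable 2 (@pos_vec R N) (dest_rate i j) }.

Section PDS.
Context (R : realType) (N : nat).
Implicit Types (S : pds R N) (v y yn : 'rV[R]_N).

Definition production S (i : 'I_N) v : R := \sum_(j < N) prod_rate S i j v.

Definition destruction S (i : 'I_N) v : R := \sum_(j < N) dest_rate S i j v.

(* [y] solves the system on the time interval [t0, t0 + T[. *)
Definition solution S (t0 T : R) (y : R -> 'rV[R]_N) : Prop :=
  [/\ forall t, t \in `[t0, t0 + T[ -> nonneg_vec (y t),
      {within `[t0, t0 + T[, continuous y} &
      forall t, t \in `]t0, t0 + T[ -> forall i,
        is_derive t 1 (fun s => y s 0 i)
          (production S i (y t) - destruction S i (y t))].

Definition positive_pds S : Prop :=
  forall (T : R) (y : R -> 'rV[R]_N), solution S 0 T y -> pos_vec (y 0) ->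
    forall t, 0 < t < T -> pos_vec (y t).

Definition fully_conservative S : Prop :=
  forall v, nonneg_vec v ->
    (forall i j, prod_rate S i j v = dest_rate S j i v) /\
    (forall i, prod_rate S i i v = 0 /\ dest_rate S i i v = 0).

(* A one-step scheme may be implicit, so it is given as a relation:
   [scheme S yn dt yn1] means that [yn1] is an outcome of one step of size [dt]
   started from [yn]. *)
Definition second_order_accurate
    (scheme : pds R N -> 'rV[R]_N -> R -> 'rV[R]_N -> Prop) : Prop :=
  forall S, positive_pds S -> fully_conservative S ->
  forall yn, pos_vec yn ->
  forall (tn T : R) (y : R -> 'rV[R]_N),
    0 < T -> solution S tn T y -> y tn = yn ->
  forall yn1 : R -> 'rV[R]_N,
    (\forall dt \near 0^'+, scheme S yn dt (yn1 dt)) ->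
  forall i : 'I_N,
    (fun dt : R => yn1 dt 0 i - y (tn + dt) 0 i) =O_ (0^'+)
      (fun dt : R => dt ^+ 3).

Section MPRK22.
Context (delta a21 b1 b2 : R).

Definition mprk22_pi yn (i : 'I_N) : R := yn 0 i.

Definition mprk22_sigma yn y2 (i : 'I_N) : R :=
  yn 0 i * (y2 0 i / yn 0 i) `^ (1 / a21).

Definition mprk22_stage2 S yn (dt : R) y1 y2 : Prop :=
  forall i : 'I_N,
    y2 0 i = yn 0 i + a21 * dt * \sum_(j < N)
      (prod_rate S i j y1 * (1 - delta)
       + prod_rate S i j y1 * (y2 0 j / mprk22_pi yn j) * delta
       - dest_rate S i j y1 * (y2 0 i / mprk22_pi yn i)).

Definition mprk22_update S yn (dt : R) y1 y2 yn1 : Prop :=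
  forall i : 'I_N,
    yn1 0 i = yn 0 i + dt * \sum_(j < N)
      ((b1 * prod_rate S i j y1 + b2 * prod_rate S i j y2)
         * (yn1 0 j / mprk22_sigma yn y2 j)
       - (b1 * dest_rate S i j y1 + b2 * dest_rate S i j y2)
         * (yn1 0 i / mprk22_sigma yn y2 i)).

(* On fully conservative systems both implicit equations are linear with a
   nonsingular M-matrix and a positive right-hand side, so for positive [yn] and
   [dt] the vectors [y2] and [yn1] exist, are unique and are positive. *)
Definition mprk22 S yn (dt : R) yn1 : Prop :=
  exists y1 y2, [/\ y1 = yn, mprk22_stage2 S yn dt y1 y2 &
                    mprk22_update S yn dt y1 y2 yn1].

End MPRK22.
End PDS.

(* Main.v *)
Require Import Defs.
From mathcomp Require Import all_boot all_order all_algebra.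
From mathcomp Require Import all_classical all_reals all_analysis.
From mathcomp Require Import ring lra.
Import Order.TTheory GRing.Theory Num.Theory.

(** Write [f] for the right-hand side of the system and [y^n] for the initial
    value.  The exact solution and the scheme are both shown to equal
      [y^n + dt f(y^n) + dt^2/2 f'(y^n) f(y^n) + O(dt^3)],
    so they differ by [O(dt^3)].

    For the exact solution ([solution_taylor]) the expansion is found by a
    bootstrap: a bound [O(dt^k)] on the derivative of a curve gives a bound
    [O(dt^(k+1))] on the curve ([bigOt_primitive]), and each estimate of the
    curve is fed back through the Taylor expansion of the rates.

    For the scheme, the second stage and the update are systems
    [x = c + dt L(x)] with [L] affine and bounded uniformly in [dt], so for
    small [dt] the term [dt L(x)] can be absorbed and [x = c + O(dt)]
    ([implicit_bigOt1]).  Inserting this estimate in the second stage gives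
    [y^(2) = y^n + a21 dt f(y^n) + O(dt^2)].  The exponent
    [1/a21] in [sigma] then cancels the factor [a21] to first order, so
    [sigma = y^n + dt f(y^n) + O(dt^2)] ([mprk22_sigma_taylor]).  In the update,
    if the Patankar weights [y^(n+1)/sigma] are [1 + O(dt^k)] then replacing
    them by [1] changes [y^(n+1)] by [O(dt^(k+1))] only ([mprk22_update_bigOt]).
    This is used twice.  The weights are first [1 + O(dt)], so
    [y^(n+1) = y^n + dt f(y^n) + O(dt^2)]; as [sigma] has this same expansion,
    they are in fact [1 + O(dt^2)], and therefore [y^(n+1)] agrees up to
    [O(dt^3)] with the explicit Runge-Kutta step built on [y^(2)].  Its
    expansion follows from [b1 + b2 = 1] and [a21 b2 = 1/2].

    The rates are only known through their partial derivatives, so their Taylor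
    expansion along a curve ([C1_bigOt1], [C2_taylor]) is derived from a
    coordinate-by-coordinate mean value theorem
    ([multivariate_mean_value]). *)

Set Implicit Arguments.
Unset Strict Implicit.
Unset Printing Implicit Defensive.

Local Open Scope classical_set_scope.
Local Open Scope ring_scope.

(** * Orders of vanishing at 0 from the right *)

Section OrderCalculus.
Context {R : realType}.
Implicit Types (f g h : R -> R) (k l : nat) (c : R).

Definition bigOt k g : Prop := g =O_ (0^'+) (fun t => t ^+ k).

Lemma bigOtP k g :
  bigOt k g <-> exists2 C, 0 < C & \forall t \near 0^'+, `|g t| <= C * t ^+ k.
Proof.
rewrite /bigOt eqO_exP; split=> -[C C0 H]; exists C => //; near=> t;
  have tk : 0 <= t ^+ k by rewrite exprn_ge0//; near: t; exact: nbhs_right_ge.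
  by rewrite -[t ^+ k]ger0_norm//; near: t.
by rewrite [`|t ^+ k|]ger0_norm//; near: t.
Unshelve. all: by end_near. Qed.

Lemma bigOt_le k g h : (\forall t \near 0^'+, `|g t| <= `|h t|) ->
  bigOt k h -> bigOt k g.
Proof.
move=> gh /bigOtP[C C0 H]; apply/bigOtP; exists C => //; near=> t.
by apply: (@le_trans _ _ `|h t|); near: t.
Unshelve. all: by end_near. Qed.

Lemma bigOt_near k g h : (\forall t \near 0^'+, g t = h t) ->
  bigOt k h -> bigOt k g.
Proof.
by move=> gh; apply: bigOt_le; apply: filterS gh => t ->.
Qed.

Lemma bigOt_eq k g h : g =1 h -> bigOt k h -> bigOt k g.
Proof. by move=> gh; apply: bigOt_near; exact: nearW. Qed.

Lemma bigOt_weaken k l g : (k <= l)%N -> bigOt l g -> bigOt k g.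
Proof.
move=> kl /bigOtP[C C0 H]; apply/bigOtP; exists C => //; near=> t.
apply: (@le_trans _ _ (C * t ^+ l)); first by near: t.
rewrite ler_pM2l//; apply: ler_wiXn2l => //; near: t.
exact: nbhs_right_le.
Unshelve. all: by end_near. Qed.

Lemma bigOt_cst c : bigOt 0 (fun=> c).
Proof.
apply/bigOtP; exists (`|c| + 1); first by rewrite ltr_wpDl.
by near=> t; rewrite expr0 mulr1 lerDl.
Unshelve. all: by end_near. Qed.

Lemma bigOt0 k : bigOt k (fun=> 0).
Proof.
apply/bigOtP; exists 1 => //; near=> t.
by rewrite normr0 mul1r exprn_ge0//; near: t; exact: nbhs_right_ge.
Unshelve. all: by end_near. Qed.

Lemma bigOtX k : bigOt k (fun t => t ^+ k).
Proof.
apply/bigOtP; exists 1 => //; near=> t.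
by rewrite mul1r ger0_norm// exprn_ge0//; near: t; exact: nbhs_right_ge.
Unshelve. all: by end_near. Qed.

Lemma bigOtD k f g : bigOt k f -> bigOt k g -> bigOt k (fun t => f t + g t).
Proof.
move=> /bigOtP[C C0 Hf] /bigOtP[D D0 Hg]; apply/bigOtP.
exists (C + D); first exact: addr_gt0.
near=> t; rewrite mulrDl (le_trans (ler_normD _ _))// lerD//; near: t => //.
Unshelve. all: by end_near. Qed.

Lemma bigOtN k f : bigOt k f -> bigOt k (fun t => - f t).
Proof. by apply: bigOt_le; apply: nearW => t; rewrite normrN. Qed.

Lemma bigOtB k f g : bigOt k f -> bigOt k g -> bigOt k (fun t => f t - g t).
Proof. by move=> Hf Hg; apply: bigOtD => //; exact: bigOtN. Qed.

Lemma bigOt_norm k f : bigOt k f -> bigOt k (fun t => `|f t|).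
Proof. by apply: bigOt_le; apply: nearW => t; rewrite normr_id. Qed.

Lemma bigOtM k l f g :
  bigOt k f -> bigOt l g -> bigOt (k + l) (fun t => f t * g t).
Proof.
move=> /bigOtP[C C0 Hf] /bigOtP[D D0 Hg]; apply/bigOtP.
exists (C * D); first exact: mulr_gt0.
near=> t; rewrite exprD mulrACA normrM; apply: ler_pM => //; near: t => //.
Unshelve. all: by end_near. Qed.

Lemma bigOtZ k c f : bigOt k f -> bigOt k (fun t => c * f t).
Proof. by move=> Hf; exact: (bigOtM (bigOt_cst c) Hf). Qed.

Lemma bigOt_mult k f : bigOt k f -> bigOt k.+1 (fun t => t * f t).
Proof. by move=> Hf; exact: (bigOtM (bigOtX 1) Hf). Qed.

Lemma bigOt_sum k (I : finType) (F : I -> R -> R) :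
  (forall i, bigOt k (F i)) -> bigOt k (fun t => \sum_i F i t).
Proof.
move=> HF; elim: (index_enum I) => [|i s IH].
  by apply: (bigOt_eq _ (bigOt0 k)) => t; rewrite big_nil.
by apply: (bigOt_eq _ (bigOtD (HF i) IH)) => t; rewrite big_cons.
Qed.

Lemma cvg_bigOt0 f c : f t @[t --> 0^'+] --> c -> bigOt 0 f.
Proof.
move=> /cvgrPdist_lt/(_ 1 ltr01) fc; apply/bigOtP.
exists (`|c| + 1); first by rewrite ltr_wpDl.
near=> t; rewrite expr0 mulr1.
have -> : f t = c - (c - f t) by rewrite subKr.
rewrite (le_trans (ler_normB _ _))// lerD2l ltW//; near: t => //.
Unshelve. all: by end_near. Qed.

Lemma bigOt1_cvg f c : bigOt 1 (fun t => f t - c) -> f t @[t --> 0^'+] --> c.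
Proof.
move=> /bigOtP[C C0 H]; apply/cvgrPdist_le => e e0; near=> t.
rewrite distrC (@le_trans _ _ (C * t ^+ 1))//; first by near: t.
rewrite expr1 mulrC -ler_pdivlMr//; near: t; apply: nbhs_right_le.
exact: divr_gt0.
Unshelve. all: by end_near. Qed.

Lemma bigOt0_inv f c : c != 0 -> bigOt 1 (fun t => f t - c) ->
  bigOt 0 (fun t => (f t)^-1).
Proof. by move=> c0 /bigOt1_cvg fc; apply: cvg_bigOt0; apply: cvgV fc. Qed.

Lemma bigOt2_bigOt1 (g : R -> R) (a c : R) :
  bigOt 2 (fun t => g t - a - t * c) -> bigOt 1 (fun t => g t - a).
Proof.
move=> /(bigOt_weaken (isT : (1 <= 2)%N)) g1.
apply: (bigOt_eq _ (bigOtD g1 (bigOt_mult (bigOt_cst c)))) => t.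
by rewrite subrK.
Qed.

(** The weight minus one is [(z - s) / s], where [s] stays away from 0. *)
Lemma bigOt_ratio k (z s : R -> R) (c : R) : 0 < c ->
  bigOt 1 (fun t => s t - c) -> bigOt k (fun t => z t - s t) ->
  bigOt k (fun t => z t / s t - 1).
Proof.
move=> c0 sc zs.
apply: (@bigOt_near _ _ (fun t => (z t - s t) * (s t)^-1)).
  have /cvgrPdist_lt/(_ _ c0) := bigOt1_cvg sc.
  apply: filterS => t; rewrite ltr_norml => /andP[_ st].
  have s0 : s t != 0 by rewrite gt_eqF//; lra.
  by rewrite mulrBl mulfV.
rewrite -[k]addn0; apply: bigOtM zs _; apply: bigOt0_inv sc.
by rewrite gt_eqF.
Qed.

End OrderCalculus.

(** * Mean value theorems in one variable *)

Section MeanValue.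
Context {R : realType}.

(** Increments [h] of either sign are allowed; the intermediate point is given
    by its offset [s] from [a], so that [|s| <= |h|] transfers every order of
    [h] to [s]. *)
Lemma mean_value (f df : R -> R) (a h : R) :
  (forall s, `|s| <= `|h| -> is_derive (a + s) 1 f (df (a + s))) ->
  exists2 s, `|s| <= `|h| & f (a + h) - f a = df (a + s) * h.
Proof.
move=> H; have H' x : `|x - a| <= `|h| -> is_derive x 1 f (df x).
  by move=> /H; rewrite subrKC.
have mvt u v : u <= v -> (forall x, u <= x <= v -> `|x - a| <= `|h|) ->
    exists2 c, u <= c <= v & f v - f u = df c * (v - u).
  move=> uv uvh.
  have D x : x \in `[u, v] -> is_derive x 1 f (df x).
    by rewrite in_itv/= => /uvh; exact: H'.
  have Doo x : x \in `]u, v[ -> is_derive x 1 f (df x).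
    by move=> xuv; apply: D; exact: subset_itv_oo_cc.
  have fc : {within `[u, v], continuous f}.
    by apply: derivable_within_continuous => x /D[].
  have [c + E] := MVT_segment uv Doo fc.
  by rewrite in_itv; exists c.
have [h0|h0] := leP 0 h.
- have [||c /andP[ac cah] E] := mvt a (a + h).
  + by rewrite lerDl.
  + by move=> x /andP[? ?]; rewrite !ger0_norm; lra.
  + exists (c - a); first by rewrite !ger0_norm; lra.
    by rewrite subrKC E; ring.
- have [||c /andP[ac cah] E] := mvt (a + h) a.
  + by rewrite gerDl ltW.
  + by move=> x /andP[? ?]; rewrite (ltr0_norm h0) ler0_norm; lra.
  + exists (c - a); first by rewrite (ltr0_norm h0) ler0_norm; lra.
    by rewrite subrKC -opprB E; ring.
Qed.

(** By the mean value theorem on [[0, t]] the increment of [g] is [t] times a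
    value of [dg], which gains one power of [t].  At 0 only continuity from
    the right is assumed, which is all that a solution has at its initial
    time. *)
Lemma bigOt_primitive k (g dg : R -> R) (T : R) : 0 < T ->
  (forall t, 0 < t < T -> is_derive t 1 g (dg t)) ->
  g t @[t --> 0^'+] --> g 0 ->
  bigOt k dg -> bigOt k.+1 (fun t => g t - g 0).
Proof.
move=> T0 Dg g0 /bigOtP[C C0]; rewrite near_withinE => -[/= e e0 He].
apply/bigOtP; exists C => //; near=> t.
have t0 : 0 < t by near: t; exact: nbhs_right_gt.
have te : t < e by near: t; exact: nbhs_right_lt.
have tT : t < T by near: t; exact: nbhs_right_lt.
have D s : s \in `]0, t] -> is_derive s 1 g (dg s).
  by rewrite in_itv/= => /andP[? ?]; apply: Dg; lra.
have cont s : s \in `]0, t] -> {for s, continuous g}.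
  by move=> /D[/derivable1_diffP/differentiable_continuous].
have Doo s : s \in `]0, t[ -> is_derive s 1 g (dg s).
  by move=> st; apply: D; exact: subset_itv_oo_oc.
have gc : {within `[0, t], continuous g}.
  apply/continuous_within_itvP => //; split => //.
    by move=> s st; apply: cont; exact: subset_itv_oo_oc.
  by apply: cvg_at_left_filter; apply: cont; rewrite in_itv/= t0 lexx.
have [c + ->] := MVT t0 Doo gc.
rewrite in_itv/= => /andP[c0 ct].
rewrite subr0 normrM (gtr0_norm t0) exprSr mulrA ler_pM2r//.
have /He : `|0 - c| < e by rewrite sub0r normrN gtr0_norm//; lra.
move=> /(_ c0) /le_trans; apply; rewrite ler_pM2l//.
by apply: lerXn2r; rewrite ?nnegrE; lra.
Unshelve. all: by end_near. Qed.

(** [bigOt_primitive] applied to [g] minus the integrated polynomial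
    [c0 t + c1 t^2/2]. *)
Lemma primitive_taylor k (g dg : R -> R) (T c0 c1 : R) :
  0 < T ->
  (forall t, 0 < t < T -> is_derive t 1 g (dg t)) ->
  g t @[t --> 0^'+] --> g 0 ->
  bigOt k (fun t => dg t - c0 - t * c1) ->
  bigOt k.+1 (fun t => g t - g 0 - t * c0 - t ^+ 2 / 2 * c1).
Proof.
move=> T0 Dg g0 Hdg.
pose p : R -> R := c0 \*: id + (c1 / 2) \*: (id ^+ 2).
have pE t : p t = t * c0 + t ^+ 2 / 2 * c1.
  by rewrite /p !fctE /= /GRing.scale /=; ring.
have Dp (t : R) : is_derive t 1 p (c0 + t * c1).
  by apply: is_derive_eq; rewrite /GRing.scale /=; field.
have pc : p t @[t --> 0^'+] --> p 0.
  apply: cvg_at_right_filter; have [D _] := Dp 0.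
  by apply/differentiable_continuous/derivable1_diffP.
apply: (@bigOt_eq _ _ _ (fun t => (g - p) t - (g - p) 0)).
  by move=> t; rewrite !fctE !pE; ring.
apply: (@bigOt_primitive _ _ (fun t => dg t - (c0 + t * c1)) T) => //.
- by move=> t /Dg ?; apply: is_deriveB.
- exact: cvgB.
- by apply: bigOt_eq Hdg => t; ring.
Qed.

End MeanValue.

(** * First and second order expansions *)

Section TaylorPow.
Context {R : realType}.
Implicit Types (w : R -> R) (q c : R).

Lemma powR_mean_value q (x : R) : `|x| < 1 ->
  exists2 s : R, `|s| <= `|x| & (1 + x) `^ q - 1 = q * (1 + s) `^ (q - 1) * x.
Proof.
move=> x1.
have D s : `|s| <= `|x| ->
    is_derive (1 + s) 1 ((@powR R)^~ q) (q * (1 + s) `^ (q - 1)).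
  move=> sx; apply: is_derive1_powR.
  by move: (le_lt_trans sx x1); rewrite ltr_norml; lra.
have [s sx E] := mean_value (df := fun z => q * z `^ (q - 1)) D.
by exists s => //; rewrite -E powR1.
Qed.

(** Choosing the intermediate point for every [t] makes it a curve [s] that is
    itself [O(t)], so the calculus of orders applies to it. *)
Lemma powR_mean_value_curve q w : bigOt 1 w -> exists s : R -> R, bigOt 1 s /\
  \forall t \near 0^'+, (1 + w t) `^ q - 1 = q * (1 + s t) `^ (q - 1) * w t.
Proof.
move=> w1.
pose P t z := `|w t| < 1 -> `|z| <= `|w t| /\
    (1 + w t) `^ q - 1 = q * (1 + z) `^ (q - 1) * w t.
have [|s Hs] := @choice _ _ P.
  move=> t; rewrite /P; have [/(powR_mean_value q)[z]|_] := ltP `|w t| 1.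
    by exists z.
  by exists 0.
have wlt : \forall t \near 0^'+, `|w t| < 1.
  have w0 : w t @[t --> 0^'+] --> (0 : R).
    by apply: bigOt1_cvg; apply: bigOt_eq w1 => t; rewrite subr0.
  by move/cvgr0Pnorm_lt: w0; apply; exact: ltr01.
exists s; split; first by apply: bigOt_le w1; apply: filterS wlt => t /Hs[].
by apply: filterS wlt => t /Hs[].
Qed.

Lemma powR_bigOt1 q w : bigOt 1 w -> bigOt 1 (fun t => (1 + w t) `^ q - 1).
Proof.
move=> w1; have [s [s1]] := powR_mean_value_curve q w1.
move=> /bigOt_near; apply.
apply: (@bigOtM _ 0 1) => //; apply: bigOtZ.
apply: (@cvg_bigOt0 _ _ (1 `^ (q - 1))).
have cont : {for 1, continuous (fun z : R => z `^ (q - 1))}.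
  have [D _] := is_derive1_powR (q - 1) (@ltr01 R).
  by apply/differentiable_continuous/derivable1_diffP.
have s0 : 1 + s t @[t --> 0^'+] --> (1 : R).
  by apply: bigOt1_cvg; apply: bigOt_eq s1 => t; rewrite addrC addKr.
exact: (cvg_comp _ _ s0 cont).
Qed.

(** The derivative [q (1 + s)^(q-1)] at the intermediate point is [q + O(t)] by
    [powR_bigOt1], and it multiplies [w = O(t)]. *)
Lemma powR_taylor q c w : bigOt 2 (fun t => w t - t * c) ->
  bigOt 2 (fun t => (1 + w t) `^ q - 1 - t * (q * c)).
Proof.
move=> w2.
have w1 : bigOt 1 w.
  have w20 : bigOt 2 (fun t => w t - 0 - t * c).
    by apply: bigOt_eq w2 => t; rewrite subr0.
  by apply: (bigOt_eq _ (bigOt2_bigOt1 w20)) => t; rewrite subr0.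
have [s [s1 E]] := powR_mean_value_curve q w1.
pose r t := q * ((1 + s t) `^ (q - 1) - 1) * w t + q * (w t - t * c).
apply: (@bigOt_near _ _ _ r).
  by apply: filterS E => t ->; rewrite /r; ring.
apply: bigOtD; last exact: bigOtZ.
by apply: (@bigOtM _ 1 1) => //; apply: bigOtZ; exact: powR_bigOt1.
Qed.

End TaylorPow.

Section TaylorVec.
Context {R : realType} {N : nat}.
Implicit Types (f : 'rV[R]_N -> R) (v y z : 'rV[R]_N) (u : R -> 'rV[R]_N).

Local Notation e_ j := (delta_mx (0 : 'I_1) j : 'rV[R]_N).

(** Reading a partial derivative as an ordinary derivative lets the one-variable
    mean value theorem be used on coordinate lines: it is the derivative
    of the restriction of [f] to that line, at any parameter [s]. *)
Lemma is_derive_line f v y (s : R) : derivable f (y + s *: v) v ->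
  is_derive s 1 (fun r => f (y + r *: v)) ('D_v f (y + s *: v)).
Proof.
have E : (fun h => h^-1 *: (((fun r => f (y + r *: v)) \o shift s) (h *: 1)
     - f (y + s *: v))) =
   (fun h => h^-1 *: ((f \o shift (y + s *: v)) (h *: v) - f (y + s *: v))).
  apply/funext => h /=; congr (_ *: (f _ - _)).
  by rewrite scaler1 scalerDl addrCA.
by move=> D; split; rewrite /derivable /derive E.
Qed.

Lemma rV_cvg u y : (forall k, bigOt 1 (fun t => u t 0 k - y 0 k)) ->
  u t @[t --> 0^'+] --> y.
Proof.
move=> H; apply/cvgrPdist_le => /= e e0; near=> t.
rewrite /Num.Def.normr/= mx_normrE (bigmax_le _ (ltW e0))//= => -[i k] _.
rewrite !mxE/= (ord1 i) {i}; move: k; near: t.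
apply: filter_forall => k.
by have /cvgrPdist_le/(_ _ e0) := bigOt1_cvg (H k).
Unshelve. all: by end_near. Qed.

(** Existence of the partial derivatives does not make [f] differentiable, so
    there is no mean value theorem along the segment from [y] to [z].  Instead
    the coordinates of [y] are replaced by those of [z] one at a time, and each
    of these moves is along a coordinate line.  All points met stay in the box
    centred at [y] with corner [z], hence the coordinatewise bound on [xi]. *)
Lemma multivariate_mean_value f y z :
  (forall v, (forall k, `|v 0 k - y 0 k| <= `|z 0 k - y 0 k|) ->
     forall j, derivable f v (e_ j)) ->
  exists xi : 'I_N -> 'rV[R]_N,
    (forall j k, `|xi j 0 k - y 0 k| <= `|z 0 k - y 0 k|) /\
    f z - f y = \sum_j 'D_(e_ j) f (xi j) * (z 0 j - y 0 j).
Proof.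
move=> D.
pose w m : 'rV[R]_N := \row_(k < N) (if (k < m)%N then z 0 k else y 0 k).
have wS (j : 'I_N) : w j.+1 = w j + (z 0 j - y 0 j) *: e_ j.
  apply/rowP => k; rewrite !mxE ltnS eqxx /=; case: (ltngtP k j) => [kj|kj|kj].
  - by rewrite -val_eqE /= ltn_eqF// mulr0 addr0.
  - by rewrite -val_eqE /= gtn_eqF// mulr0 addr0.
  - by rewrite (val_inj kj) eqxx mulr1 subrKC.
have wbox (j : 'I_N) (s : R) : `|s| <= `|z 0 j - y 0 j| ->
    forall k, `|(w j + s *: e_ j) 0 k - y 0 k| <= `|z 0 k - y 0 k|.
  move=> sj k; rewrite !mxE eqxx /=; have [->|kj] := eqVneq k j.
    by rewrite ltnn mulr1 [_ + s]addrC addrK.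
  by rewrite mulr0 addr0; case: ifP => // _; rewrite subrr normr0.
have step (j : 'I_N) : exists x : 'rV[R]_N,
    (forall k, `|x 0 k - y 0 k| <= `|z 0 k - y 0 k|) /\
    f (w j.+1) - f (w j) = 'D_(e_ j) f x * (z 0 j - y 0 j).
  have [s sj E] := @mean_value R (fun r => f (w j + r *: e_ j))
    (fun r => 'D_(e_ j) f (w j + r *: e_ j)) 0 (z 0 j - y 0 j)
    (fun s sj => is_derive_line
       (D _ (wbox j (0 + s) (ltac:(by rewrite add0r))) j)).
  rewrite !add0r scale0r addr0 -wS in E.
  by exists (w j + s *: e_ j); split => //; exact: wbox.
have [xi Hxi] := choice step; exists xi.
split => [j|]; first by have [] := Hxi j.
have -> : z = w N by apply/rowP => k; rewrite mxE ltn_ord.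
have -> : f (w N) - f y = f (w N) - f (w 0%N).
  by congr (_ - f _); apply/rowP => k; rewrite mxE.
rewrite -(telescope_sumr (fun m => f (w m)) (leq0n N)) big_mkord.
by apply: eq_bigr => j _; have [_ ->] := Hxi j; rewrite [in RHS]mxE ltn_ord.
Qed.

(** For small [t] the box centred at [y] with corner [u t] lies in the positive
    orthant, so that the intermediate points exist; they are chosen for each [t]
    and tend to [y] at least as fast as [u]. *)
Lemma mean_value_curve f y u :
  continuously_differentiable 1 (@pos_vec R N) f -> pos_vec y ->
  (forall k, bigOt 1 (fun t => u t 0 k - y 0 k)) ->
  exists xi : 'I_N -> R -> 'rV[R]_N,
    (forall j k, bigOt 1 (fun t => xi j t 0 k - y 0 k)) /\
    \forall t \near 0^'+,
      f (u t) - f y = \sum_j 'D_(e_ j) f (xi j t) * (u t 0 j - y 0 j).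
Proof.
move=> [_ C1] y0 u1.
pose P t (xi : 'I_N -> 'rV[R]_N) := (forall k, `|u t 0 k - y 0 k| < y 0 k) ->
  (forall j k, `|xi j 0 k - y 0 k| <= `|u t 0 k - y 0 k|) /\
    f (u t) - f y = \sum_j 'D_(e_ j) f (xi j) * (u t 0 j - y 0 j).
have [|xi Hxi] := @choice _ _ P.
  move=> t; have [H|H] := pselect (forall k, `|u t 0 k - y 0 k| < y 0 k).
    have [|xi ?] := @multivariate_mean_value f y (u t); last by exists xi.
    move=> v Hv j; apply: (C1 j).1 => k.
    by move: (le_lt_trans (Hv k) (H k)); rewrite ltr_norml; lra.
  by exists (fun=> y) => /H.
have near_pos : \forall t \near 0^'+, forall k, `|u t 0 k - y 0 k| < y 0 k.
  apply: filter_forall => k.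
  have /cvgrPdist_lt/(_ _ (y0 k)) := bigOt1_cvg (u1 k).
  by apply: filterS => t; rewrite distrC.
exists (fun j t => xi t j); split => [j k|].
  by apply: bigOt_le (u1 k); apply: filterS near_pos => t /Hxi[].
by apply: filterS near_pos => t /Hxi[].
Qed.

Lemma C1_bigOt1 f y u :
  continuously_differentiable 1 (@pos_vec R N) f -> pos_vec y ->
  (forall k, bigOt 1 (fun t => u t 0 k - y 0 k)) ->
  bigOt 1 (fun t => f (u t) - f y).
Proof.
move=> C1 y0 u1; have [xi [xi1]] := mean_value_curve C1 y0 u1.
move=> /bigOt_near; apply; apply: bigOt_sum => j; apply: (@bigOtM _ 0 1) => //.
have cont : {for y, continuous (fun v => 'D_(e_ j) f v)}.
  by have [_ /(_ j)[_ [/(_ y y0)]]] := C1.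
apply: (@cvg_bigOt0 _ _ ('D_(e_ j) f y)).
exact: (cvg_comp _ _ (rV_cvg (xi1 j)) cont).
Qed.

Lemma C2_C1 (A : set 'rV[R]_N) f :
  continuously_differentiable 2 A f -> continuously_differentiable 1 A f.
Proof.
move=> [fc fd]; split => // j; have [fdj [fdc _]] := fd j.
by split => //; split.
Qed.

(** In the mean value formula, [C1_bigOt1] applied to the partial derivatives
    replaces their intermediate points by [y] at the cost of [O(t) * O(t)]. *)
Lemma C2_taylor f y u (c : 'I_N -> R) :
  continuously_differentiable 2 (@pos_vec R N) f -> pos_vec y ->
  (forall k, bigOt 2 (fun t => u t 0 k - y 0 k - t * c k)) ->
  bigOt 2 (fun t => f (u t) - f y - t * \sum_j 'D_(e_ j) f y * c j).
Proof.
move=> C2 y0 u2.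
have u1 k : bigOt 1 (fun t => u t 0 k - y 0 k) := bigOt2_bigOt1 (u2 k).
have [xi [xi1 E]] := mean_value_curve (C2_C1 C2) y0 u1.
pose r t := \sum_j (('D_(e_ j) f (xi j t) - 'D_(e_ j) f y) * (u t 0 j - y 0 j)
                    + 'D_(e_ j) f y * (u t 0 j - y 0 j - t * c j)).
apply: (@bigOt_near _ _ _ r).
  apply: filterS E => t ->; rewrite /r mulr_sumr -sumrB; apply: eq_bigr => j _.
  by ring.
apply: bigOt_sum => j; apply: bigOtD; last exact: bigOtZ.
apply: (@bigOtM _ 1 1) => //.
apply: (@C1_bigOt1 (fun v => 'D_(e_ j) f v)) => //.
by have [_ /(_ j)[]] := C2.
Qed.

End TaylorVec.

(** * Linearly implicit equations with a small step *)

Lemma ler_term_sum (R : numDomainType) (I : finType) (F : I -> R) i :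
  (forall j, 0 <= F j) -> F i <= \sum_j F j.
Proof. by move=> F0; rewrite (bigD1 i)//= lerDl sumr_ge0. Qed.

(** Summing the equations bounds the total deviation [M] from [c] by
    [t C (K + M)], with [C] a bound on the coefficients and [K] depending on [c]
    only.  As soon as [t C <= 1/2] the term in [M] on the right is absorbed,
    whence [M <= 2 C K t].  The terms [e i j * x i] stand for the destruction
    terms of the scheme, whose unknown has the row index. *)
Lemma implicit_bigOt1 (R : realType) N (x : 'I_N -> R -> R) (c : 'I_N -> R)
    (a b e : 'I_N -> 'I_N -> R -> R) :
  (forall i j, bigOt 0 (a i j)) -> (forall i j, bigOt 0 (b i j)) ->
  (forall i j, bigOt 0 (e i j)) ->
  (\forall t \near 0^'+, forall i, x i t =
     c i + t * \sum_j (a i j t + b i j t * x j t + e i j t * x i t)) ->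
  forall i, bigOt 1 (fun t => x i t - c i).
Proof.
move=> a0 b0 e0 E i.
pose A t := \sum_i \sum_j (`|a i j t| + `|b i j t| + `|e i j t|).
have /bigOtP[C C0 HC] : bigOt 0 A.
  do 2![apply: bigOt_sum => ?]; apply: bigOtD; last exact: bigOt_norm.
  by apply: bigOtD; exact: bigOt_norm.
pose M t := \sum_i `|x i t - c i|; pose K := 1 + \sum_i `|c i|.
have K0 : 0 < K by rewrite ltr_pwDl// sumr_ge0.
apply/bigOtP; exists (2 * C * K); first by rewrite mulr_gt0// mulr_gt0.
near=> t; rewrite expr1.
have t0 : 0 < t by near: t; exact: nbhs_right_gt.
have At : A t <= C.
  by apply: le_trans (ler_norm _) _; rewrite -[C]mulr1 -(expr0 t); near: t.
have tC : t * C <= 1 / 2.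
  rewrite -ler_pdivlMr//; near: t; apply: nbhs_right_le.
  by rewrite divr_gt0.
have xle j : `|x j t| <= K - 1 + M t.
  have -> : x j t = c j + (x j t - c j) by rewrite subrKC.
  rewrite (le_trans (ler_normD _ _))// lerD//.
    by rewrite /K addrC addKr; exact: (ler_term_sum (F := fun k => `|c k|)).
  exact: (ler_term_sum (F := fun k => `|x k t - c k|)).
have M0 : 0 <= M t by rewrite sumr_ge0.
have xc j : `|x j t - c j| <=
    t * (K + M t) * \sum_k (`|a j k t| + `|b j k t| + `|e j k t|).
  have Ej : x j t - c j =
      t * \sum_k (a j k t + b j k t * x k t + e j k t * x j t).
    apply: (addrI (c j)); rewrite subrKC; move: j; near: t; exact: E.
  rewrite Ej normrM gtr0_norm// -mulrA ler_pM2l// mulr_sumr.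
  rewrite (le_trans (ler_norm_sum _ _ _))// ler_sum// => k _.
  rewrite !mulrDr (le_trans (ler_normD _ _))// lerD//.
    rewrite (le_trans (ler_normD _ _))// lerD//.
      by rewrite ler_peMl// /K -addrA lerDl addr_ge0// sumr_ge0.
    by rewrite normrM mulrC ler_wpM2r// (le_trans (xle k))// lerD2r gerBl.
  by rewrite normrM mulrC ler_wpM2r// (le_trans (xle j))// lerD2r gerBl.
have Mle : M t <= t * (K + M t) * C.
  apply: (@le_trans _ _ (t * (K + M t) * A t)).
    by rewrite /A mulr_sumr; apply: ler_sum => j _; exact: xc.
  by rewrite ler_wpM2l// mulr_ge0 ?(ltW t0)// addr_ge0// ltW.
apply: (@le_trans _ _ (M t)).
  exact: (ler_term_sum (F := fun k => `|x k t - c k|)).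
nra.
Unshelve. all: by end_near. Qed.

(** * The exact solution *)

Section Expansion.
Context {R : realType} {N : nat}.
Implicit Types (S : pds R N) (y : 'rV[R]_N) (u : R -> 'rV[R]_N).

Local Notation e_ j := (delta_mx (0 : 'I_1) j : 'rV[R]_N).

Definition net_rate S i y : R := production S i y - destruction S i y.

Definition net_rate_deriv S i y (c : 'I_N -> R) : R :=
  \sum_j (\sum_k 'D_(e_ k) (prod_rate S i j) y * c k
          - \sum_k 'D_(e_ k) (dest_rate S i j) y * c k).

(** The second derivative of the [i]-th component of a solution passing through
    [y], by the chain rule. *)
Definition accel S i y : R := net_rate_deriv S i y (fun k => net_rate S k y).

Lemma net_rateE S i y :
  net_rate S i y = \sum_j (prod_rate S i j y - dest_rate S i j y).
Proof. by rewrite /net_rate /production /destruction sumrB. Qed.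

Lemma net_rate_bigOt1 S i y u : pos_vec y ->
  (forall k, bigOt 1 (fun t => u t 0 k - y 0 k)) ->
  bigOt 1 (fun t => net_rate S i (u t) - net_rate S i y).
Proof.
move=> y0 u1; pose r j (q : 'I_N -> 'I_N -> 'rV[R]_N -> R) t :=
  q i j (u t) - q i j y.
apply: (@bigOt_eq _ _ _
  (fun t => \sum_j (r j (prod_rate S) t - r j (dest_rate S) t))).
  move=> t; rewrite !net_rateE -sumrB; apply: eq_bigr => j _; rewrite /r; ring.
apply: bigOt_sum => j; apply: bigOtB; apply: C1_bigOt1 => //; apply: C2_C1.
  exact: prod_rate_C2.
exact: dest_rate_C2.
Qed.

Lemma net_rate_taylor S i y u (c : 'I_N -> R) : pos_vec y ->
  (forall k, bigOt 2 (fun t => u t 0 k - y 0 k - t * c k)) ->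
  bigOt 2 (fun t =>
    net_rate S i (u t) - net_rate S i y - t * net_rate_deriv S i y c).
Proof.
move=> y0 u2; pose r j (q : 'I_N -> 'I_N -> 'rV[R]_N -> R) t :=
  q i j (u t) - q i j y - t * \sum_k 'D_(e_ k) (q i j) y * c k.
apply: (@bigOt_eq _ _ _
  (fun t => \sum_j (r j (prod_rate S) t - r j (dest_rate S) t))).
  move=> t; rewrite !net_rateE -sumrB mulr_sumr -sumrB.
  by apply: eq_bigr => j _; rewrite /r; ring.
apply: bigOt_sum => j; apply: bigOtB; apply: C2_taylor => //.
  exact: prod_rate_C2.
exact: dest_rate_C2.
Qed.

(** Bootstrap: continuity of the solution bounds its derivative, and each
    integration ([primitive_taylor]) gains an order that the expansion of the
    rates transfers back to the derivative. *)
Lemma solution_taylor S (tn T : R) (y : R -> 'rV[R]_N) :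
  0 < T -> solution S tn T y -> pos_vec (y tn) -> forall i,
  bigOt 3 (fun t => y (tn + t) 0 i - y tn 0 i - t * net_rate S i (y tn)
                    - t ^+ 2 / 2 * accel S i (y tn)).
Proof.
move=> T0 [_ yc yd] y0.
pose u t := y (tn + t).
have u0 : u 0 = y tn by rewrite /u addr0.
have ud i t : 0 < t < T ->
    is_derive t 1 (fun s => u s 0 i) (net_rate S i (u t)).
  move=> tT; have /yd/(_ i) D : tn + t \in `]tn, tn + T[.
    by rewrite in_itv/=; lra.
  have Ds : is_derive t 1 (cst tn + id : R -> R) 1.
    by apply: is_derive_eq; rewrite add0r.
  rewrite -[net_rate _ _ _]mulr1.
  exact: (is_derive1_comp (f := fun s => y s 0 i) D Ds).
have ycvg : u t @[t --> 0^'+] --> y tn.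
  have sub : `[tn, tn + T / 2] `<=` `[tn, tn + T[.
    by move=> t; rewrite /= !in_itv/=; lra.
  have /continuous_within_itvP := continuous_subspaceW sub yc.
  case; first by rewrite ltrDl divr_gt0.
  by move=> _ yr _ A /yr; exact: (nbhs_right0P tn _).1.
have uc i : u t 0 i @[t --> 0^'+] --> u 0 0 i.
  rewrite u0; exact: (cvg_comp _ _ ycvg (@coord_continuous _ _ _ 0 i (y tn))).
have step k c0 c1 i : bigOt k (fun t => net_rate S i (u t) - c0 - t * c1) ->
    bigOt k.+1 (fun t => u t 0 i - y tn 0 i - t * c0 - t ^+ 2 / 2 * c1).
  by rewrite -u0; exact: primitive_taylor.
have u1 i : bigOt 1 (fun t => u t 0 i - y tn 0 i).
  have H : bigOt 0 (fun t => net_rate S i (u t) - 0 - t * 0).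
    apply: (@bigOt_eq _ _ _
      (fun t => \sum_j (prod_rate S i j (u t) - dest_rate S i j (u t)))).
      by move=> t; rewrite net_rateE mulr0 !subr0.
    apply: bigOt_sum => j; apply: bigOtB.
      have [c _] := prod_rate_C2 S i j.
      exact: cvg_bigOt0 (cvg_comp _ _ ycvg (c _ y0)).
    have [c _] := dest_rate_C2 S i j.
    exact: cvg_bigOt0 (cvg_comp _ _ ycvg (c _ y0)).
  by apply: bigOt_eq (step _ _ _ _ H) => t; ring.
have u2 i : bigOt 2 (fun t => u t 0 i - y tn 0 i - t * net_rate S i (y tn)).
  have H : bigOt 1
      (fun t => net_rate S i (u t) - net_rate S i (y tn) - t * 0).
    apply: (bigOt_eq _ (net_rate_bigOt1 S i y0 u1)) => t.
    by rewrite mulr0 subr0.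
  by apply: bigOt_eq (step _ _ _ _ H) => t; ring.
move=> i; apply: step; exact: net_rate_taylor.
Qed.

End Expansion.

(** * The scheme *)

Section Scheme.
Context {R : realType} {N : nat}.
Context (delta a21 b1 b2 : R) (S : pds R N) (yn : 'rV[R]_N).
Context (yn_gt0 : pos_vec yn).

Local Notation f k := (net_rate S k yn).

Let yn_neq0 k : yn 0 k != 0. Proof. by rewrite gt_eqF. Qed.

(** Once [y2 - yn = O(t)] is known, replacing the weights [y2 / pi] by 1 turns
    the stage into an explicit Euler step of size [a21 t], up to [O(t^2)].  The
    switch [delta] only moves production terms between the explicit and the
    weighted part, so it drops out at this order. *)
Lemma mprk22_stage2_taylor (y2 : R -> 'rV[R]_N) :
  (\forall t \near 0^'+, mprk22_stage2 delta a21 S yn t yn (y2 t)) ->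
  forall i, bigOt 2 (fun t => y2 t 0 i - yn 0 i - t * (a21 * f i)).
Proof.
move=> E i.
have y21 : forall k, bigOt 1 (fun t => y2 t 0 k - yn 0 k).
  apply: (@implicit_bigOt1 _ _ (fun k t => y2 t 0 k) (fun k => yn 0 k)
    (fun k j _ => a21 * prod_rate S k j yn * (1 - delta))
    (fun k j _ => a21 * prod_rate S k j yn * delta / yn 0 j)
    (fun k j _ => - (a21 * dest_rate S k j yn / yn 0 k))).
  - by move=> *; exact: bigOt_cst.
  - by move=> *; exact: bigOt_cst.
  - by move=> *; exact: bigOt_cst.
  apply: filterS E => t Et k.
  rewrite {1}Et -mulrA [a21 * _]mulrC -mulrA mulr_suml.
  congr (_ + _ * _); apply: eq_bigr => j _.
  by rewrite /mprk22_pi; field; rewrite !yn_neq0.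
pose r t := t * \sum_j (a21 * prod_rate S i j yn * delta / yn 0 j
                          * (y2 t 0 j - yn 0 j)
                        - a21 * dest_rate S i j yn / yn 0 i
                          * (y2 t 0 i - yn 0 i)).
apply: (@bigOt_near _ _ _ r).
  apply: filterS E => t Et; rewrite {1}Et /r net_rateE [yn 0 i + _]addrC addrK.
  rewrite [a21 * t]mulrC -mulrA -!mulrBr -sumrB; congr (_ * _).
  rewrite mulr_sumr; apply: eq_bigr => j _.
  by rewrite /mprk22_pi; field; rewrite !yn_neq0.
apply: bigOt_mult; apply: bigOt_sum => j.
by apply: bigOtB; apply: bigOtZ.
Qed.

(** [(1 + a21 t f / yn)^(1 / a21) = 1 + t f / yn + O(t^2)]: the exponent
    rescales the stage at time [a21 t] to a first order approximation at time
    [t]. *)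
Lemma mprk22_sigma_taylor (y2 : R -> 'rV[R]_N) i : a21 != 0 ->
  bigOt 2 (fun t => y2 t 0 i - yn 0 i - t * (a21 * f i)) ->
  bigOt 2 (fun t => mprk22_sigma a21 yn (y2 t) i - yn 0 i - t * f i).
Proof.
move=> a0 y22.
have w2 : bigOt 2 (fun t => (y2 t 0 i / yn 0 i - 1) - t * (a21 * f i / yn 0 i)).
  apply: (bigOt_eq _ (bigOtZ (yn 0 i)^-1 y22)) => t.
  by field; rewrite yn_neq0.
apply: (bigOt_eq _ (bigOtZ (yn 0 i) (powR_taylor (1 / a21) w2))) => t.
by rewrite subrKC /mprk22_sigma; field; rewrite a0 yn_neq0.
Qed.

Section Update.
Context (y2 z : R -> 'rV[R]_N).
Context (update :
  \forall t \near 0^'+, mprk22_update a21 b1 b2 S yn t yn (y2 t) (z t)).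

Local Notation sigma i t := (mprk22_sigma a21 yn (y2 t) i).
Local Notation P i j t :=
  (b1 * prod_rate S i j yn + b2 * prod_rate S i j (y2 t)).
Local Notation Q i j t :=
  (b1 * dest_rate S i j yn + b2 * dest_rate S i j (y2 t)).

(** The factor [t] in front of the sum gains one order over the accuracy [k] to
    which the weights [z / sigma] are 1 and the averaged rates are replaced by
    [p] and [q].  It is used with constant [p], [q] for [k = 1], and with the
    first order expansions of the averaged rates for [k = 2]. *)
Lemma mprk22_update_bigOt k (p q : 'I_N -> 'I_N -> R -> R) :
  (forall i j, bigOt 0 (fun t => P i j t)) ->
  (forall i j, bigOt 0 (fun t => Q i j t)) ->
  (forall i j, bigOt k (fun t => P i j t - p i j t)) ->
  (forall i j, bigOt k (fun t => Q i j t - q i j t)) ->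
  (forall j, bigOt k (fun t => z t 0 j / sigma j t - 1)) ->
  forall i, bigOt k.+1 (fun t =>
    z t 0 i - yn 0 i - t * \sum_j (p i j t - q i j t)).
Proof.
move=> P0 Q0 Pp Qq zs i.
pose r t := t * \sum_j (P i j t * (z t 0 j / sigma j t - 1)
                        + (P i j t - p i j t)
                        - (Q i j t * (z t 0 i / sigma i t - 1)
                           + (Q i j t - q i j t))).
apply: (@bigOt_near _ _ _ r).
  apply: filterS update => t Et; rewrite {1}Et /r [yn 0 i + _]addrC addrK.
  rewrite -mulrBr -sumrB; congr (_ * _); apply: eq_bigr => j _; ring.
apply: bigOt_mult; apply: bigOt_sum => j.
by apply: bigOtB; apply: bigOtD => //; apply: (@bigOtM _ 0 k).
Qed.

Context (b_sum : b1 + b2 = 1) (order2 : a21 * b2 = 1 / 2).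
Context (y2_taylor :
  forall i, bigOt 2 (fun t => y2 t 0 i - yn 0 i - t * (a21 * f i))).

(** The weights [z / sigma] are first known to be [1 + O(t)], which gives the
    first order expansion of [z].  Since [sigma] has the same expansion, the
    weights are [1 + O(t^2)], and [mprk22_update_bigOt] applies once more. *)
Lemma mprk22_update_taylor i :
  bigOt 3 (fun t => z t 0 i - yn 0 i - t * f i - t ^+ 2 / 2 * accel S i yn).
Proof.
have a0 : a21 != 0 by apply/eqP => a0; move: order2; rewrite a0 mul0r; lra.
have b1E : b1 = 1 - b2 by rewrite -b_sum addrK.
have y2_1 k : bigOt 1 (fun t => y2 t 0 k - yn 0 k).
  exact: bigOt2_bigOt1 (y2_taylor k).
have s2 k := mprk22_sigma_taylor a0 (y2_taylor k).
have s1 k : bigOt 1 (fun t => sigma k t - yn 0 k) := bigOt2_bigOt1 (s2 k).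
(* [b1 + b2 = 1] matches the value of the averaged rate, and [a21 b2 = 1/2] its
   derivative, with those at the midpoint [yn + (t/2) f]. *)
have avg (q : 'rV[R]_N -> R) : continuously_differentiable 2 (@pos_vec R N) q ->
    bigOt 1 (fun t => b1 * q yn + b2 * q (y2 t) - q yn) /\
    bigOt 2 (fun t => b1 * q yn + b2 * q (y2 t) - (q yn + t / 2 *
      \sum_k 'D_(delta_mx 0 k : 'rV[R]_N) q yn * f k)).
  move=> C2; split.
    apply: (bigOt_eq _ (bigOtZ b2 (C1_bigOt1 (C2_C1 C2) yn_gt0 y2_1))) => t.
    by rewrite b1E; ring.
  apply: (bigOt_eq _ (bigOtZ b2 (C2_taylor C2 yn_gt0 y2_taylor))) => t.
  under [in RHS]eq_bigr => k _ do rewrite mulrCA.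
  rewrite -mulr_sumr; have -> : t / 2 = t * (a21 * b2) by rewrite order2; field.
  by rewrite b1E; ring.
have bounded (q : 'rV[R]_N -> R) :
    continuously_differentiable 2 (@pos_vec R N) q ->
    bigOt 0 (fun t => b1 * q yn + b2 * q (y2 t)).
  move=> /avg[q1 _]; have q0 := bigOt_weaken (leq0n 1) q1.
  by apply: (bigOt_eq _ (bigOtD q0 (bigOt_cst (q yn)))) => t; rewrite subrK.
have P0 k j := bounded _ (prod_rate_C2 S k j).
have Q0 k j := bounded _ (dest_rate_C2 S k j).
have sV k : bigOt 0 (fun t => (sigma k t)^-1) := bigOt0_inv (yn_neq0 k) (s1 k).
have z1 : forall k, bigOt 1 (fun t => z t 0 k - yn 0 k).
  apply: (@implicit_bigOt1 _ _ (fun k t => z t 0 k) (fun k => yn 0 k)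
    (fun k j _ => 0) (fun k j t => P k j t / sigma j t)
    (fun k j t => - (Q k j t / sigma k t))).
  - by move=> *; exact: bigOt0.
  - by move=> k j; exact: (bigOtM (P0 k j) (sV j)).
  - by move=> k j; apply: bigOtN; exact: (bigOtM (Q0 k j) (sV k)).
  apply: filterS update => t Et k; rewrite {1}Et.
  by congr (_ + _ * _); apply: eq_bigr => j _; ring.
have ratio m : (forall k, bigOt m (fun t => z t 0 k - sigma k t)) ->
    forall k, bigOt m (fun t => z t 0 k / sigma k t - 1).
  by move=> zs k; apply: (@bigOt_ratio _ _ _ _ (yn 0 k)).
have zs1 : forall k, bigOt 1 (fun t => z t 0 k / sigma k t - 1).
  apply: ratio => k; apply: (bigOt_eq _ (bigOtB (z1 k) (s1 k))) => t.
  by ring.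
have z2 k : bigOt 2 (fun t => z t 0 k - yn 0 k - t * f k).
  rewrite net_rateE.
  apply: (mprk22_update_bigOt (k := 1) (p := fun k j _ => prod_rate S k j yn)
    (q := fun k j _ => dest_rate S k j yn)) => // l j.
    by have [] := avg _ (prod_rate_C2 S l j).
  by have [] := avg _ (dest_rate_C2 S l j).
have zs2 : forall k, bigOt 2 (fun t => z t 0 k / sigma k t - 1).
  apply: ratio => k; apply: (bigOt_eq _ (bigOtB (z2 k) (s2 k))) => t.
  by ring.
pose slope (q : 'rV[R]_N -> R) (t : R) := q yn + t / 2 *
  \sum_k 'D_(delta_mx 0 k : 'rV[R]_N) q yn * f k.
apply: (@bigOt_eq _ _ _ (fun t => z t 0 i - yn 0 i -
    t * \sum_j (slope (prod_rate S i j) t - slope (dest_rate S i j) t))).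
  move=> t; rewrite net_rateE /accel /net_rate_deriv -!addrA.
  congr (_ + (_ + _)).
  rewrite !mulr_sumr -opprD -big_split; congr (- _); apply: eq_bigr => j _ /=.
  by rewrite /slope; field.
apply: (mprk22_update_bigOt (p := fun k j => slope (prod_rate S k j))
    (q := fun k j => slope (dest_rate S k j))) => // l j.
  by have [] := avg _ (prod_rate_C2 S l j).
by have [] := avg _ (dest_rate_C2 S l j).
Qed.

End Update.
End Scheme.

Unset Implicit Arguments.

Theorem theorem3p6 (R : realType) (N : nat) (delta a21 b1 b2 : R)
  (delta01 : delta = 0 \/ delta = 1)
  (a21_ge0 : 0 <= a21) (b1_ge0 : 0 <= b1) (b2_ge0 : 0 <= b2)
  (b_sum : b1 + b2 = 1) (order2 : a21 * b2 = 1 / 2) :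
  second_order_accurate (@mprk22 R N delta a21 b1 b2).
Proof.
move=> S _ _ yn yn0 tn T y T0 ysol ytn z Hz i.
(* The stage values are only given for each step size; they are collected
   into a curve, with a dummy value where the scheme has no outcome. *)
pose stage t y2 := mprk22 delta a21 b1 b2 S yn t (z t) ->
  mprk22_stage2 delta a21 S yn t yn y2 /\
  mprk22_update a21 b1 b2 S yn t yn y2 (z t).
have [|y2 Hy2] := @choice _ _ stage.
  move=> t; have [[_ [y2 [-> E1 E2]]]|nz] :=
    pselect (mprk22 delta a21 b1 b2 S yn t (z t)).
    by exists y2.
  by exists yn => /nz.
have E1 : \forall t \near 0^'+, mprk22_stage2 delta a21 S yn t yn (y2 t).
  by apply: filterS Hz => t /Hy2[].
have E2 : \forall t \near 0^'+, mprk22_update a21 b1 b2 S yn t yn (y2 t) (z t).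
  by apply: filterS Hz => t /Hy2[].
have y2T := mprk22_stage2_taylor yn0 E1.
have zT := mprk22_update_taylor yn0 E2 b_sum order2 y2T i.
have yT : bigOt 3 (fun t => y (tn + t) 0 i - yn 0 i - t * net_rate S i yn
                            - t ^+ 2 / 2 * accel S i yn).
  by rewrite -ytn; apply: (solution_taylor T0 ysol); rewrite ytn.
apply: (bigOt_eq _ (bigOtB zT yT)) => t; ring.
Qed.
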